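(* Let $\mathcal{H}$ be a real separable Hilbert space, let $\mathcal{D}(F)\subset\mathcal{H}$ be open, and let $F:\mathcal{D}(F)\to\mathcal{H}$ be a demicontinuous, bounded operator which is monotone on a closed convex set $\mathcal{M}\subset\mathcal{D}(F)$. Let $f_*\in\mathcal{H}$ be such that the equation $Fu=f_*$ has a solution belonging to $\mathcal{M}$. Assume that $F$ is Fréchet differentiable on $\mathcal{D}(F)$ and that, for some finite constant $L\ge 0$, $$\|F'(u)-F'(v)\|\le L\|u-v\|\quad\text{for all }u,v\in\mathcal{M}.$$ Suppose that $F$ is cocoercive on $\mathcal{M}$, and that there are $u_*\in\mathcal{M}$ and $z\in\mathcal{H}$ with $$Fu_*=f_*,\qquad u_*=F'(u_* )^*z,\qquad \varrho:=\|z\|,\qquad \varrho L<2.$$ For each $\alpha>0$ let $u_\alpha\in\mathcal{M}$ be the (unique) element satisfying $$\langle Fu_\alpha+\alpha u_\alpha-f_*,\,v-u_\alpha\rangle\ge 0\quad\text{for all }v\in\mathcal{M}.$$ Then $$\|u_\alpha-u_*\|=\mathcal{O}(\alpha^{1/2})\quad\text{and}\quad\|Fu_\alpha-f_*\|=\mathcal{O}(\alpha)\quad\text{as }\alpha\to 0.$$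
   Context: Let $\langle\cdot,\cdot\rangle$ and $\|\cdot\|$ denote the inner product and norm of $\mathcal{H}$ (and $\|\cdot\|$ also the operator norm); $F'(u)$ is the Fréchet derivative (a bounded linear operator on $\mathcal{H}$) and $F'(u)^*$ its Hilbert space adjoint. The (generally nonlinear) operator $F:\mathcal{D}(F)\to\mathcal{H}$ is called: - monotone on $\mathcal{M}\subset\mathcal{D}(F)$ if $\langle Fu-Fv,u-v\rangle\ge 0$ for all $u,v\in\mathcal{M}$; - cocoercive on $\mathcal{M}\subset\mathcal{D}(F)$ if there is a constant $\tau>0$ with $\langle Fu-Fv,u-v\rangle\ge\tau\|Fu-Fv\|^2$ for all $u,v\in\mathcal{M}$; - demicontinuous if for each $v\in\mathcal{D}(F)$ and each sequence $(v_n)\subset\mathcal{D}(F)$ with $v_n\to v$ in norm, $Fv_n\rightharpoonup Fv$ weakly; - bounded if it maps bounded subsets of $\mathcal{D}(F)$ to bounded subsets of $\mathcal{H}$. *)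

(* Defs.v *)
From HB Require Import structures.
From mathcomp Require Import all_boot all_order all_algebra.
From mathcomp Require Import sesquilinear ring lra.
From mathcomp Require Import all_classical all_reals all_analysis.

Set Implicit Arguments.
Unset Strict Implicit.
Unset Printing Implicit Defensive.

Import Order.TTheory GRing.Theory Num.Theory.
Import numFieldNormedType.Exports.

Local Open Scope classical_set_scope.
Local Open Scope ring_scope.

Section Hilbert.
Context {R : realType} {H : completeNormedModType R}.
Implicit Types (ip : {dot H for idfun}) (A B F : H -> H) (D M : set H).

(* [H] with the inner product [ip] is a real Hilbert space: the complete norm
   of [H] is the one induced by [ip]. *)
Definition hilbert_norm ip := forall x : H, `|x| = Num.sqrt (ip x x).

Definition separable_space (T : topologicalType) :=
  exists2 S : set T, countable S & dense S.

(* The set is bounded above when [A] is linear and continuous; on other maps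
   [sup] may return its default value 0. *)
Definition opnorm A : R := sup [set `|A x| | x in [set x : H | `|x| <= 1]].

Definition is_adjoint ip A B := forall x y : H, ip (A x) y = ip x (B y).

(* Chosen by description; [adjointP] below shows that it is the adjoint of every
   bounded linear operator, and [ip] being definite makes it unique. *)
Definition adjoint ip A : H -> H := xget (fun=> 0) [set B | is_adjoint ip A B].

Definition weakly_cvg ip (x_ : nat -> H) (x : H) :=
  forall w : H, ip (x_ n) w @[n --> \oo] --> ip x w.

(* An operator [F : D(F) -> H] is a total map together with the set [D = D(F)];
   its values outside [D] play no role. *)
Definition monotone_on ip M F :=
  forall u v, M u -> M v -> 0 <= ip (F u - F v) (u - v).

Definition cocoercive_on ip M F :=
  exists2 tau : R, 0 < tau &
    forall u v, M u -> M v -> tau * `|F u - F v| ^+ 2 <= ip (F u - F v) (u - v).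

Definition demicontinuous_on ip D F :=
  forall (v : H) (v_ : nat -> H), D v -> (forall n, D (v_ n)) ->
    v_ n @[n --> \oo] --> v -> weakly_cvg ip (F \o v_) (F v).

Definition bounded_on D F :=
  forall S : set H, S `<=` D -> bounded_set S -> bounded_set (F @` S).

End Hilbert.

Section AdjointExists.
Context {R : realType} {H : completeNormedModType R}.
Context (ip : {dot H for idfun}) (ipN : hilbert_norm ip).

Lemma ipC x y : ip x y = ip y x.
Proof. by rewrite hermitian_subproof expr0 mul1r. Qed.

Lemma ipDl x y z : ip (x + y) z = ip x z + ip y z.
Proof. exact: linearDl. Qed.

Lemma ipZl a x z : ip (a *: x) z = a * ip x z.
Proof. exact: linearZl_LR. Qed.

Lemma ipNl x z : ip (- x) z = - ip x z.
Proof. exact: linearNl. Qed.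

Lemma ipDr x y z : ip z (x + y) = ip z x + ip z y.
Proof. by rewrite ipC ipDl !(ipC _ z). Qed.

Lemma ipZr a x z : ip z (a *: x) = a * ip z x.
Proof. by rewrite ipC ipZl (ipC _ z). Qed.

Lemma ipNr x z : ip z (- x) = - ip z x.
Proof. by rewrite ipC ipNl (ipC _ z). Qed.

Lemma ip_sqr x : ip x x = `|x| ^+ 2.
Proof.
rewrite ipN sqr_sqrtr//; have [->|x0] := eqVneq x 0.
  by rewrite -(scale0r (0 : H)) ipZl mul0r.
exact/ltW/neq0_dnorm_gt0.
Qed.

Lemma cauchy_schwarz x y : `|ip x y| <= `|x| * `|y|.
Proof.
have [->|y0] := eqVneq y 0.
  by rewrite -(scale0r (0 : H)) ipZr mul0r normr0 mulr_ge0.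
rewrite -ler_sqr ?nnegrE ?mulr_ge0// real_normK ?num_real//.
have yy : 0 < `|y| ^+ 2 by rewrite exprn_gt0 // normr_gt0.
have : 0 <= ip (`|y| ^+ 2 *: x - ip x y *: y) (`|y| ^+ 2 *: x - ip x y *: y).
  by rewrite ip_sqr sqr_ge0.
rewrite !(ipDl, ipDr, ipNl, ipNr, ipZl, ipZr) (ipC y x) !ip_sqr => h.
rewrite -(ler_pM2l yy) exprMn -subr_ge0; apply: le_trans h _.
by rewrite le_eqVlt; apply/orP; left; apply/eqP; ring.
Qed.

Lemma riesz (phi : H -> R) (C : R) :
  (forall a x y, phi (a *: x + y) = a * phi x + phi y) ->
  0 < C -> (forall x, `|phi x| <= C * `|x|) ->
  exists y, forall x, phi x = ip x y.
Proof.
move=> phiP C0 hC.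
have phi0 : phi 0 = 0.
  have /eqP := phiP 1 0 0; rewrite scaler0 addr0 mul1r.
  by rewrite -subr_eq0 opprD addrA subrr sub0r oppr_eq0 => /eqP.
have phiZ a x : phi (a *: x) = a * phi x by rewrite -[_ *: x]addr0 phiP phi0 addr0.
have phiD x y : phi (x + y) = phi x + phi y by rewrite -[x]scale1r phiP scale1r mul1r.
pose J x : R := ip x x - 2 * phi x.
have JC x : - C ^+ 2 <= J x.
  rewrite /J ip_sqr; have := hC x; have := ler_norm (phi x).
  have := sqr_ge0 (`|x| - C); lra.
pose E := range J.
have hE : has_inf E.
  split; first by exists (J 0), 0.
  by exists (- C ^+ 2) => _ [x _ <-].
pose m := inf E.
have mJ x : m <= J x by apply: ge_inf; [exact: hE.2|exists x].
have /choice[x_ hx] : forall n : nat, exists x, J x < m + n.+1%:R^-1.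
  move=> n; have [|_ [x _ <-] Jx] := @inf_adherent _ E n.+1%:R^-1 _ hE; last by exists x.
  by rewrite invr_gt0.
have par a b : `|a - b| ^+ 2 = 2 * J a + 2 * J b - 4 * J (2^-1 *: (a + b)).
  rewrite -ip_sqr /J phiZ phiD !(ipDl, ipDr, ipNl, ipNr, ipZl, ipZr).
  by rewrite (ipC b a); field.
have dist a b n : (n <= a)%N -> (n <= b)%N -> `|x_ a - x_ b| ^+ 2 < 4 * n.+1%:R^-1.
  move=> na nb; rewrite par.
  have na' : (a.+1%:R^-1 : R) <= n.+1%:R^-1 by rewrite lef_pV2 ?posrE// ler_nat.
  have nb' : (b.+1%:R^-1 : R) <= n.+1%:R^-1 by rewrite lef_pV2 ?posrE// ler_nat.
  have ha := lt_le_trans (hx a) (lerD (lexx m) na').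
  have hb := lt_le_trans (hx b) (lerD (lexx m) nb').
  have := mJ (2^-1 *: (x_ a + x_ b)).
  move: ha hb; set s := n.+1%:R^-1; clearbody s; lra.
have small e : 0 < e -> exists n : nat, (n.+1%:R^-1 : R) < e.
  move=> e0; have [n _ hn] := near_infty_natSinv_lt (PosNum e0).
  by exists n; exact: hn (leqnn n).
have : cauchy (x_ @ \oo).
  apply/cauchyP => e e0.
  have [n hn] := small (e ^+ 2 / 4) ltac:(by rewrite divr_gt0 // exprn_gt0).
  exists (x_ n); exists n => // k /= nk; rewrite -ball_normE /=.
  rewrite -ltr_sqr ?nnegrE ?(ltW e0)//; move: hn (dist n k n (leqnn _) nk).
  by set s := n.+1%:R^-1; clearbody s; lra.
move=> /cauchy_cvg cv; pose y := lim (x_ @ \oo); exists y => h.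
apply/eqP; rewrite -subr_eq0 -normr_eq0 eq_le normr_ge0 andbT.
have near_ n : `|phi h - ip h (x_ n)| ^+ 2 <= `|h| ^+ 2 * n.+1%:R^-1.
  have [->|h0] := eqVneq h 0.
    rewrite phi0 -(scale0r (0 : H)) ipZl mul0r subrr normr0 expr0n /=.
    by rewrite scale0r normr0 expr0n /= mul0r.
  have hh : 0 < `|h| ^+ 2 by rewrite exprn_gt0 // normr_gt0.
  set d := phi h - ip h (x_ n).
  have := mJ (x_ n + (d / `|h| ^+ 2) *: h); have := hx n.
  rewrite /J phiD phiZ !(ipDl, ipDr, ipNl, ipNr, ipZl, ipZr).
  rewrite (ipC (x_ n) h) !ip_sqr real_normK ?num_real//.
  have -> : ip h (x_ n) = phi h - d by rewrite /d; ring.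
  set s := n.+1%:R^-1; set q := `|h| ^+ 2 in hh *.
  set t := d / q => h1 h2.
  have dE : d = t * q by rewrite /t divfK // gt_eqF.
  have : t ^+ 2 * q <= s by rewrite dE in h2; nra.
  move=> h3; rewrite dE (_ : (t * q) ^+ 2 = q * (t ^+ 2 * q)); last by ring.
  by rewrite ler_pM2l.
have c1 : (fun n => `|phi h - ip h (x_ n)|) @ \oo --> `|phi h - ip h y|.
  apply: cvg_norm; apply: cvgB; first exact: cvg_cst.
  apply/cvgrPdist_lt => e e0.
  have h1 : 0 < `|h| + 1 by rewrite ltr_wpDl.
  have /cvgrPdist_lt/(_ (e / (`|h| + 1))) : x_ @ \oo --> y by exact: cv.
  move=> /(_ ltac:(by rewrite divr_gt0)); apply: filterS => n.
  rewrite ltr_pdivlMr// => yx; rewrite -ipNr -ipDr.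
  apply: le_lt_trans (cauchy_schwarz _ _) _; apply: le_lt_trans yx.
  by rewrite mulrC ler_wpM2l // lerDl.
rewrite -ler_sqr ?nnegrE// expr0n/= -[leRHS](mulr0 (`|h| ^+ 2)).
have c2 : (fun n => `|h| ^+ 2 * harmonic n) @ \oo --> `|h| ^+ 2 * (0 : R).
  by apply: cvgM; [exact: cvg_cst|exact: cvg_harmonic].
by apply: (ler_cvg_to (cvgM c1 c1) c2); apply: nearW => n; exact: near_.
Qed.

Lemma adjointP (A : {linear H -> H}) : continuous A ->
  is_adjoint ip A (adjoint ip A).
Proof.
move=> cA; rewrite /adjoint; case: xgetP => [B _ AB //|/= noB].
have [C C0 hC] : exists2 C, 0 < C & forall x, `|A x| <= C * `|x|.
  have /linear_boundedP[r [rR /(_ (`|r| + 1))]] :=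
    continuous_linear_bounded 0 (cA 0).
  move=> h; exists (`|r| + 1); first by rewrite ltr_wpDl.
  by apply: h; rewrite (le_lt_trans (ler_norm _))// ltrDl.
have /choice[B AB] : forall y, exists b, forall x, ip (A x) y = ip x b.
  move=> y; apply: (@riesz _ (C * (`|y| + 1))).
  - by move=> a x x'; rewrite linearP ipDl ipZl.
  - by rewrite mulr_gt0 // ltr_wpDl.
  - move=> x; apply: le_trans (cauchy_schwarz _ _) _; rewrite mulrAC.
    by apply: ler_pM => //; rewrite lerDl.
by exfalso; apply: (noB B) => x y; exact: AB.
Qed.

End AdjointExists.

(* Main.v *)
Require Import Defs.
From mathcomp Require Import all_boot all_order all_algebra.
From mathcomp Require Import sesquilinear ring lra.
From mathcomp Require Import all_classical all_reals all_analysis.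
Import Order.TTheory GRing.Theory Num.Theory.
Import numFieldNormedType.Exports.
Local Open Scope classical_set_scope.
Local Open Scope ring_scope.

(** Testing the variational inequality at [v = ustar] and using the source
    condition [ustar = F'(ustar)^* z], with [e := ua - ustar] and
    [G := F ua - fstar], gives
      [<G, e> + alpha |e|^2 <= - alpha <F'(ustar) e, z>].
    By the Taylor estimate [|G - F'(ustar) e| <= (L / 2) |e|^2] the right-hand
    side is at most [alpha |z| (|G| + (L / 2) |e|^2)], so cocoercivity yields
      [tau |G|^2 + alpha (1 - |z| L / 2) |e|^2 <= alpha |z| |G|].
    Dropping the second term bounds [|G|] by a multiple of [alpha]; dropping the
    first one then bounds [|e|^2] by a multiple of [alpha]. *)

Section Operators.
Context {R : realType} {H : completeNormedModType R}.

Lemma continuous_linear_bound (A : {linear H -> H}) : continuous A ->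
  exists2 C, 0 < C & forall x, `|A x| <= C * `|x|.
Proof.
move=> cA; have /linear_boundedP[r [rR /(_ (`|r| + 1)) h]] :=
  continuous_linear_bounded 0 (cA 0).
exists (`|r| + 1); first by rewrite ltr_wpDl.
by apply: h; rewrite (le_lt_trans (ler_norm _))// ltrDl.
Qed.

(** Continuity bounds the set under [sup], so [opnorm A] is a genuine upper bound; apply it to [x]
    scaled to norm 1. *)
Lemma le_opnorm (A : {linear H -> H}) (x : H) : continuous A ->
  `|A x| <= opnorm A * `|x|.
Proof.
move=> /continuous_linear_bound[C C0 hC].
have [->|x0] := eqVneq x 0; first by rewrite linear0 !normr0 mulr0.
have nx : 0 < `|x| by rewrite normr_gt0.
rewrite -ler_pdivrMr//; apply: ub_le_sup.
  exists C => _ [y /= y1 <-]; apply: le_trans (hC y) _.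
  by rewrite ler_piMr // ltW.
exists (`|x|^-1 *: x) => /=; first by rewrite normrZ normfV normr_id mulVf ?gt_eqF.
by rewrite linearZ normrZ normfV normr_id mulrC.
Qed.

Lemma convex_set_segment (M : set H) (u v : H) (t : R) : convex_set M ->
  M u -> M v -> 0 <= t <= 1 -> M (u + t *: (v - u)).
Proof.
move=> cM Mu Mv t01.
have i01 : Itv.spec (@Itv.num_sem R) (Itv.Real `[0%Z, 1%Z]) t.
  by rewrite /= /Itv.num_sem num_real/= in_itv/=.
have := cM v u (Itv.mk i01) (mem_set Mv) (mem_set Mu); rewrite inE.
by rewrite /conv /= /unstable.onem scalerBl scale1r scalerBr addrCA.
Qed.

Context {ip : {dot H for idfun}} (ipN : hilbert_norm ip).

(** By Cauchy-Schwarz; dividing by [|w| + 1] instead of [|w|] covers [w = 0]. *)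
Lemma cvg_ipl (T : Type) (E : set_system T) {FE : Filter E}
    (f : T -> H) (l w : H) :
  f @ E --> l -> (fun t => ip (f t) w) @ E --> ip l w.
Proof.
move=> fl; apply/cvgrPdist_lt => e e0.
have w1 : 0 < `|w| + 1 by rewrite ltr_wpDl.
have /cvgrPdist_lt/(_ (e / (`|w| + 1))) := fl.
move=> /(_ ltac:(by rewrite divr_gt0)); apply: filterS => t.
rewrite ltr_pdivlMr// => h; rewrite -ipNl -ipDl.
apply: le_lt_trans (cauchy_schwarz ipN _ _) _; apply: le_lt_trans h.
by rewrite ler_wpM2l // lerDl.
Qed.

Lemma is_derive_ip_line (F : H -> H) (u e w : H) (t : R) :
  differentiable F (u + t *: e) ->
  is_derive t 1 (fun s : R => ip (F (u + s *: e)) w)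
    (ip ('d F (u + t *: e) e) w).
Proof.
move=> dF; rewrite -deriveE//.
have cF := @diff_derivable _ _ _ _ _ e dF.
have c : (fun h : R => h^-1 *: (((fun s : R => ip (F (u + s *: e)) w)
    \o shift t) (h *: (1 : R)) - ip (F (u + t *: e)) w)) @ 0^' -->
    ip ('D_e F (u + t *: e)) w.
  rewrite [X in X @ _](_ : _ = fun h : R =>
      ip (h^-1 *: ((F \o shift (u + t *: e)) (h *: e) - F (u + t *: e))) w).
    exact: cvg_ipl.
  apply/funext => h /=; rewrite ipZl ipDl ipNl.
  by rewrite [h *: 1]mulr1 scalerDl addrCA.
split; first by apply/cvg_ex; eexists; exact: c.
exact/cvg_lim/c.
Qed.

(** Pairing with [w] makes the remainder scalar, so the mean value theorem along the segment from
    [u] to [v] replaces an integral of the derivative. *)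
Lemma taylor_lipschitz_diff (M : set H) (F : H -> H) (L : R) (u v w : H) :
  convex_set M -> (forall x, M x -> differentiable F x) ->
  (forall x y, M x -> M y -> opnorm ('d F x \- 'd F y) <= L * `|x - y|) ->
  M u -> M v ->
  ip (F v - F u - 'd F u (v - u)) w <= L / 2 * `|v - u| ^+ 2 * `|w|.
Proof.
move=> cM dF lipF Mu Mv; set e := v - u.
have Mt (t : R) : 0 <= t <= 1 -> M (u + t *: e) by exact: convex_set_segment.
set a := ip ('d F u e) w; set k := L * `|e| ^+ 2 * `|w|.
(* The quadratic term is what yields the sharp factor 1/2: its derivative [k * t] dominates the
   growth of the derivative of [F] paired with [w]. *)
pose g (t : R) : R := ip (F (u + t *: e)) w - (t * a + k / 2 * t ^+ 2).
pose dg (t : R) : R := ip ('d F (u + t *: e) e) w - (a + k * t).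
have dgP (t : R) : 0 <= t <= 1 -> is_derive t 1 g (dg t).
  move=> t01; have d1 := is_derive_ip_line F u e w t (dF _ (Mt _ t01)).
  have d2 : is_derive t 1 (fun s : R => s * a + k / 2 * s ^+ 2) (a + k * t).
    apply: is_derive_eq.
    by rewrite scaler0 add0r /GRing.scale /= !mulr1; field.
  exact: is_deriveB.
have [|||c c01] := @MVT R g dg 0 1.
- by [].
- by move=> t; rewrite in_itv/= => /andP[t0 t1]; apply: dgP; rewrite !ltW.
- apply: derivable_within_continuous => t; rewrite in_itv/= => t01.
  by have [] := dgP t t01.
move: c01; rewrite in_itv/= => /andP[c0 c1].
rewrite subr0 mulr1 => gE.
(* The points [u + c *: e] and [u] are [c * |e|] apart, so the Lipschitz bound gives exactly
   [k * c]. *)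
have : dg c <= 0.
  rewrite /dg subr_le0 -lerBlDl /a -ipNl -ipDl.
  apply: le_trans (ler_norm _) _; apply: le_trans (cauchy_schwarz ipN _ _) _.
  have Mc : M (u + c *: e) by apply: Mt; rewrite !ltW.
  have cA : continuous ('d F (u + c *: e) \- 'd F u).
    by move=> x; apply: cvgB; apply: diff_continuous; exact: dF.
  have h := le_opnorm _ e cA.
  rewrite /k mulrAC ler_wpM2r//.
  have := lipF _ _ Mc Mu; rewrite (addrAC u) subrr add0r normrZ (gtr0_norm c0) => lip.
  apply: le_trans h _; apply: le_trans (ler_wpM2r (normr_ge0 e) lip) _.
  by rewrite le_eqVlt; apply/orP; left; apply/eqP; ring.
rewrite -gE /g !(scale1r, scale0r) addr0 addrCA subrr addr0.
rewrite !ipDl !ipNl -/a /k; lra.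
Qed.

End Operators.

(** The witness is [C + 1] because the big-O constant must be positive while [C] may vanish. *)
Lemma bigO_at_right0 {R : realType} (f g : R -> R) (C : R) : 0 <= C ->
  (forall x, 0 < x -> `|f x| <= C * `|g x|) -> f =O_ (0^'+) g.
Proof.
move=> C0 fg; apply/eqO_exP; exists (C + 1); first by rewrite ltr_wpDl.
near=> x; apply: le_trans (fg x _) _; first by near: x; exact: nbhs_right_gt.
by rewrite ler_wpM2r// lerDl.
Unshelve. all: by end_near. Qed.

Theorem theorem4p6 (R : realType) (H : completeNormedModType R)
  (ip : {dot H for idfun}) (H_hilbert : hilbert_norm ip)
  (H_separable : separable_space H)
  (D M : set H) (F : H -> H) (fstar ustar z : H) (L : R) (ua : R -> H)
  (D_open : open D)
  (F_demicont : demicontinuous_on ip D F)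
  (F_bounded : bounded_on D F)
  (M_closed : closed M) (M_convex : convex_set M) (M_sub : M `<=` D)
  (F_monotone : monotone_on ip M F)
  (F_solvable : exists2 u : H, M u & F u = fstar)
  (F_diff : forall u : H, D u -> differentiable F u)
  (L_ge0 : 0 <= L)
  (F_lip : forall u v : H, M u -> M v ->
     opnorm ('d F u \- 'd F v) <= L * `|u - v|)
  (F_coco : cocoercive_on ip M F)
  (Mustar : M ustar) (Fustar : F ustar = fstar)
  (ustar_source : ustar = adjoint ip ('d F ustar) z)
  (z_small : `|z| * L < 2)
  (ua_sol : forall alpha : R, 0 < alpha -> M (ua alpha) /\
     forall v : H, M v ->
       0 <= ip (F (ua alpha) + alpha *: ua alpha - fstar) (v - ua alpha)) :
  (fun alpha : R => `|ua alpha - ustar|)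
    =O_ (0^'+) (fun alpha : R => alpha `^ (1 / 2)) /\
  (fun alpha : R => `|F (ua alpha) - fstar|)
    =O_ (0^'+) (fun alpha : R => alpha).
Proof.
have [tau tau0 coco] := F_coco.
have dF x : M x -> differentiable F x by move=> /M_sub; exact: F_diff.
set rho := `|z|.
have rho0 : 0 <= rho by rewrite /rho.
(* The smallness condition lets the quadratic Taylor remainder be absorbed on the left. *)
have kappa0 : 0 < 1 - rho * L / 2 by rewrite /rho; move: z_small; lra.
set kappa := 1 - rho * L / 2 in kappa0.
have key (alpha : R) : 0 < alpha ->
    tau * `|F (ua alpha) - fstar| ^+ 2 + alpha * kappa * `|ua alpha - ustar| ^+ 2
    <= alpha * rho * `|F (ua alpha) - fstar|.
  move=> a0; have [Mua /(_ _ Mustar)] := ua_sol _ a0.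
  have := coco _ _ Mua Mustar; rewrite Fustar.
  set e := ua alpha - ustar; set G := F (ua alpha) - fstar => coc.
  have -> : ustar - ua alpha = - e by rewrite /e opprB.
  have -> : F (ua alpha) + alpha *: ua alpha - fstar =
            G + alpha *: e + alpha *: ustar.
    by rewrite -[RHS]addrA -scalerDr /e subrK /G addrAC.
  have src : ip ustar e = ip ('d F ustar e) z.
    rewrite {1}ustar_source ipC -(adjointP H_hilbert) //.
    exact: diff_continuous (dF _ Mustar).
  rewrite ipNr ipDl ipDl !ipZl src (ip_sqr H_hilbert) => vi.
  (* Only an upper bound on the remainder paired with [z] and a lower bound on [ip G z] are
     needed. *)
  have := taylor_lipschitz_diff H_hilbert _ _ _ _ _ z M_convex dF F_lip Mustar Mua.
  rewrite Fustar -/e -/G ipDl ipNl -/rho => tay.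
  have := cauchy_schwarz H_hilbert G z; rewrite ler_norml -/rho => /andP[cs _].
  have : - ip ('d F ustar e) z <= rho * `|G| + L / 2 * `|e| ^+ 2 * rho.
    by move: tay cs; lra.
  move=> /(ler_wpM2l (ltW a0)) h.
  by rewrite /kappa; move: h vi coc; lra.
have G_le (alpha : R) : 0 < alpha -> `|F (ua alpha) - fstar| <= rho / tau * alpha.
  move=> a0; have := key _ a0.
  set g := `|F _ - _|; set e2 := `|_ - ustar| ^+ 2 => h.
  have e20 : 0 <= alpha * kappa * e2.
    by rewrite !mulr_ge0 ?(ltW a0) ?(ltW kappa0) ?exprn_ge0.
  (* The bound follows by cancelling one factor [g], so [g = 0] is treated apart. *)
  have [g0|g0] := eqVneq g 0.
    by rewrite g0 mulr_ge0 ?divr_ge0 ?(ltW a0) ?(ltW tau0).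
  have gp : 0 < g by rewrite lt_neqAle eq_sym g0 /g /=.
  rewrite mulrAC ler_pdivlMr// -(ler_pM2r gp).
  by move: h e20; lra.
split; last first.
  apply: (@bigO_at_right0 _ _ _ (rho / tau)); first by rewrite divr_ge0 // ltW.
  by move=> a a0; rewrite normr_id (gtr0_norm a0); exact: G_le.
(* The constant is the square root of that in [kappa * |e|^2 <= rho * |G| <= rho^2 / tau * alpha],
   after division by [kappa]. *)
apply: (@bigO_at_right0 _ _ _ (Num.sqrt (rho ^+ 2 / (tau * kappa)))).
  exact: sqrtr_ge0.
move=> a a0; rewrite normr_id div1r powR12_sqrt ?(ltW a0)// ger0_norm ?sqrtr_ge0//.
have C0 : 0 <= rho ^+ 2 / (tau * kappa).
  by rewrite divr_ge0 ?sqr_ge0 // mulr_ge0 ?ltW.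
rewrite -sqrtrM// -[leLHS]ger0_norm// -sqrtr_sqr ler_wsqrtr//.
rewrite mulrAC ler_pdivlMr ?mulr_gt0//.
have := key _ a0; have := G_le _ a0.
set g := `|F _ - _|; set e2 := `|_ - ustar| ^+ 2.
rewrite mulrAC ler_pdivlMr// => hg hk.
have tg : 0 <= tau * g ^+ 2 by rewrite mulr_ge0 ?sqr_ge0// ltW.
have : kappa * e2 <= rho * g.
  by rewrite -(ler_pM2l a0); move: hk tg; lra.
move=> /(ler_wpM2l (ltW tau0)); have := ler_wpM2l rho0 hg; lra.
Qed.
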